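(* Let $P\in C^{2,\alpha}(a,b)$, $Q\in C^{1,\alpha}(a,b)$, and let $R:(a,b)\to\mathbb{R}$ be $F$-continuous. Consider the second $\alpha$-order fractal homogeneous equation $$P(x)D_x^{2\alpha}f(x)+Q(x)D_x^{\alpha}f(x)+R(x)f(x)=0,\qquad(\ast)$$ and suppose it is not exact. If $\mu\in C^{2,\alpha}(a,b)$ is a solution, on $F\cap(a,b)$, of the adjoint equation $$P(x)D_x^{2\alpha}\mu(x)+\bigl(2D_x^{\alpha}P(x)-Q(x)\bigr)D_x^{\alpha}\mu(x)+\bigl(D_x^{2\alpha}P(x)-D_x^{\alpha}Q(x)+R(x)\bigr)\mu(x)=0,$$ then the equation obtained by multiplying $(\ast)$ by $\mu(x)$, $$\mu(x)P(x)D_x^{2\alpha}f(x)+\mu(x)Q(x)D_x^{\alpha}f(x)+\mu(x)R(x)f(x)=0,$$ is exact.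
   Context: Let $0<\alpha\le 1$, $F\subset\mathbb{R}$, and $(a,b)$ an open interval. For an interval $I$ put $\rho(F,I)=1$ if $F\cap I\ne\emptyset$ and $0$ otherwise. For $u<v$ and $\delta>0$ let $\gamma^\alpha_\delta(F,u,v)=\inf\sum_{i=0}^{n-1}\Gamma(\alpha+1)(t_{i+1}-t_i)^\alpha\rho(F,[t_i,t_{i+1}])$, the infimum over subdivisions $u=t_0<\dots<t_n=v$ with $\max_i(t_{i+1}-t_i)\le\delta$; $\gamma^\alpha(F,u,v)=\lim_{\delta\to0}\gamma^\alpha_\delta(F,u,v)$ (and $\gamma^\alpha(F,u,u)=0$). Fix $a_0\in\mathbb{R}$. The integral staircase function is $S_F^\alpha(x)=\gamma^\alpha(F,a_0,x)$ if $x\ge a_0$ and $S_F^\alpha(x)=-\gamma^\alpha(F,x,a_0)$ otherwise. $F$ is $\alpha$-perfect: $S_F^\alpha$ is finite on $\mathbb{R}$, $F$ is closed with no isolated points, and $F$ is exactly the set of points $x$ such that $S_F^\alpha$ is not constant on any open interval containing $x$. For $x\in F$, $\mathrm{F\text{-}lim}_{y\to x}h(y)=\ell$ means: for every $\varepsilon>0$ there is $\delta>0$ with $|h(y)-\ell|<\varepsilon$ for all $y\in F$ with $0<|y-x|<\delta$. A function $h$ is $F$-continuous in $(a,b)$ if $\mathrm{F\text{-}lim}_{y\to x}h(y)=h(x)$ for all $x\in F\cap(a,b)$. The $F^\alpha$-derivative of $f:(a,b)\to\mathbb{R}$ is $D_x^\alpha f(x)=\mathrm{F\text{-}lim}_{y\to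 x}\frac{f(y)-f(x)}{S_F^\alpha(y)-S_F^\alpha(x)}$ if $x\in F$ (when the limit exists), and $0$ if $x\notin F$; $D_x^{2\alpha}f=D_x^\alpha(D_x^\alpha f)$. $C^{n,\alpha}(a,b)$ is the set of $f:(a,b)\to\mathbb{R}$ that are $n$ times $F^\alpha$-differentiable at every point of $F\cap(a,b)$. Exactness: an equation $\tilde P D_x^{2\alpha}f+\tilde Q D_x^{\alpha}f+\tilde R f=0$ is called exact if it can be transformed into the form $D_x^\alpha(\tilde P(x)D_x^\alpha f(x))+D_x^\alpha(g(x)f(x))=0$ for some function $g$ determined by $\tilde P,\tilde Q,\tilde R$; i.e. there is $g\in C^{1,\alpha}(a,b)$ such that for every $f\in C^{2,\alpha}(a,b)$ and every $x\in F\cap(a,b)$, $\tilde P D_x^{2\alpha}f+\tilde QD_x^\alpha f+\tilde Rf=D_x^\alpha(\tilde PD_x^\alpha f)+D_x^\alpha(gf)$. *)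

(* Defs.v *)
From mathcomp Require Import all_boot all_order all_algebra.
From mathcomp Require Import all_classical all_reals all_analysis.

Set Implicit Arguments.
Unset Strict Implicit.
Unset Printing Implicit Defensive.

Import Order.TTheory GRing.Theory Num.Theory.
Import numFieldNormedType.Exports.

Local Open Scope classical_set_scope.
Local Open Scope ring_scope.

Definition Gamma {R : realType} (z : R) : R :=
  \int[lebesgue_measure]_(t in `[0, +oo[) (t `^ (z - 1) * expR (- t)).

Definition rho {R : realType} (F I : set R) : R :=
  if `[< F `&` I !=set0 >] then 1 else 0.

(* A subdivision u = t_0 < ... < t_n = v is the list s = [:: t_1; ...; t_n]
   with itv_partition u v s; thus t_i is nth u (u :: s) i and n = size s. *)
Definition subdivision_sum {R : realType} (alpha : R) (F : set R) (u : R)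
    (s : seq R) : R :=
  \sum_(0 <= i < size s)
    let t := nth u (u :: s) in
    Gamma (alpha + 1) * (t i.+1 - t i) `^ alpha * rho F `[t i, t i.+1].

Definition mesh_le {R : realType} (u : R) (s : seq R) (delta : R) : Prop :=
  forall i : nat, (i < size s)%N ->
    nth u (u :: s) i.+1 - nth u (u :: s) i <= delta.

Definition mass_delta {R : realType} (alpha : R) (F : set R) (u v : R)
    (delta : R) : \bar R :=
  ereal_inf [set (subdivision_sum alpha F u s)%:E |
               s in [set s | itv_partition u v s /\ mesh_le u s delta]].

(* The limit always exists in \bar R, since mass_delta is nonincreasing in
   delta. For u = v the only subdivision is the empty list, so the value is 0. *)
Definition mass {R : realType} (alpha : R) (F : set R) (u v : R) : \bar R :=
  lim (mass_delta alpha F u v delta @[delta --> 0^'+]).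

Definition staircase {R : realType} (alpha : R) (F : set R) (a0 x : R) :
    \bar R :=
  if a0 <= x then mass alpha F a0 x else (- mass alpha F x a0)%E.

Definition alpha_perfect {R : realType} (alpha : R) (F : set R) (a0 : R) :
    Prop :=
  [/\ forall x, staircase alpha F a0 x \is a fin_num,
      closed F,
      isolated F = set0 &
      F = [set x | forall c d : R, c < x < d ->
             ~ exists k, forall y, y \in `]c, d[ ->
                 staircase alpha F a0 y = k]].

(* F-lim_{y -> x} h(y) = l is  h @ Fnear F x --> l. *)
Definition Fnear {R : realType} (F : set R) (x : R) : set_system R :=
  within F x^'.

Definition Fcontinuous {R : realType} (F : set R) (a b : R) (h : R -> R) :
    Prop :=
  forall x, F x -> a < x < b -> h y @[y --> Fnear F x] --> h x.

Definition Fquotient {R : realType} (alpha : R) (F : set R) (a0 : R)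
    (f : R -> R) (x y : R) : R :=
  (f y - f x) /
  (fine (staircase alpha F a0 y) - fine (staircase alpha F a0 x)).

Definition Fderivable {R : realType} (alpha : R) (F : set R) (a0 : R)
    (f : R -> R) (x : R) : Prop :=
  cvg (Fquotient alpha F a0 f x y @[y --> Fnear F x]).

(* Functions on (a, b) are represented by total functions R -> R. At a point
   x of F in (a, b), Fderivable and Fderive (also iterated) depend only on the
   values on F near x, hence not on the values outside (a, b).
   At x in F the value is meaningful only when Fderivable holds. *)
Definition Fderive {R : realType} (alpha : R) (F : set R) (a0 : R)
    (f : R -> R) (x : R) : R :=
  if x \in F then lim (Fquotient alpha F a0 f x y @[y --> Fnear F x]) else 0.

Definition Fderiven {R : realType} (alpha : R) (F : set R) (a0 : R) (n : nat)
    (f : R -> R) : R -> R :=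
  iter n (Fderive alpha F a0) f.

Definition Cn {R : realType} (alpha : R) (F : set R) (a0 a b : R) (n : nat) :
    set (R -> R) :=
  [set f | forall k : nat, (k < n)%N -> forall x, F x -> a < x < b ->
             Fderivable alpha F a0 (Fderiven alpha F a0 k f) x].

(* The two Fderivable clauses state that the derivatives on the right-hand
   side of the identity exist, as Fderive alone does not say so. *)
Definition exact_equation {R : realType} (alpha : R) (F : set R) (a0 a b : R)
    (P Q S : R -> R) : Prop :=
  exists2 g, Cn alpha F a0 a b 1 g &
    forall f, Cn alpha F a0 a b 2 f -> forall x, F x -> a < x < b ->
      let D := Fderive alpha F a0 in
      [/\ Fderivable alpha F a0 (fun y => P y * D f y) x,
          Fderivable alpha F a0 (fun y => g y * f y) x &
          P x * Fderiven alpha F a0 2 f x + Q x * D f x + S x * f x =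
          D (fun y => P y * D f y) x + D (fun y => g y * f y) x].

(* Main.v *)
(* Writing D for the fractal derivative, the adjoint equation says
   D (mu Q - D (mu P)) = mu S, so g = mu Q - D (mu P) turns the multiplied
   equation into D (mu P D f) + D (g f) = 0 by the product rule. The product
   rule needs F-differentiable functions to be F-continuous, hence that the
   staircase is F-continuous and, since Rocq's division by zero gives 0, that it
   takes a value different from its value at x at all other points of F near x.
   Both rest on the additivity of the mass, which gives st y - st x = mass x y
   for x <= y, where st is the staircase: so st is monotone, and if it took equal
   values at two points of F, no point of F could lie between them. *)

Require Import Defs.
From mathcomp Require Import all_boot all_order all_algebra.
From mathcomp Require Import all_classical all_reals all_analysis.
From mathcomp Require Import ring lra.

Set Implicit Arguments.
Unset Strict Implicit.
Unset Printing Implicit Defensive.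

Import Order.TTheory GRing.Theory Num.Theory.
Import numFieldNormedType.Exports.

Local Open Scope classical_set_scope.
Local Open Scope ring_scope.

(** * Sums over subdivisions and the cost of inserting a point *)

Section Subdivisions.
Context {R : realType} (alpha : R) (F : set R).
Implicit Types (u v w y delta : R) (s : seq R).

Lemma Gamma_ge0 (z : R) : 0 <= Gamma z.
Proof. by apply: Rintegral_ge0 => t _; rewrite mulr_ge0 ?powR_ge0 ?expR_ge0. Qed.

Lemma rho_ge0 (I : set R) : 0 <= rho F I.
Proof. by rewrite /rho; case: ifP. Qed.

Lemma rho_le1 (I : set R) : rho F I <= 1.
Proof. by rewrite /rho; case: ifP. Qed.

Definition piece u t : R :=
  Gamma (alpha + 1) * (t - u) `^ alpha * rho F `[u, t].

Lemma piece_ge0 u t : 0 <= piece u t.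
Proof. by rewrite /piece !mulr_ge0 ?Gamma_ge0 ?powR_ge0 ?rho_ge0. Qed.

Lemma piece_le u t delta : 0 <= alpha -> u <= t -> t - u <= delta ->
  piece u t <= Gamma (alpha + 1) * delta `^ alpha.
Proof.
move=> al ut tu; have ut0 : 0 <= t - u by rewrite subr_ge0.
rewrite /piece -[leRHS]mulr1 ler_pM ?rho_ge0 ?rho_le1 //.
  by rewrite mulr_ge0 ?Gamma_ge0 ?powR_ge0.
by rewrite ler_wpM2l ?Gamma_ge0// ge0_ler_powR// nnegrE (le_trans ut0).
Qed.

Lemma subdivision_sum_nil u : subdivision_sum alpha F u [::] = 0.
Proof. exact: big_geq. Qed.

Lemma subdivision_sum_cons u t s :
  subdivision_sum alpha F u (t :: s) = piece u t + subdivision_sum alpha F t s.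
Proof.
rewrite /subdivision_sum /= big_nat_recl//=; congr +%R.
apply: eq_big_nat => i /andP[_ si].
(* The two sides use [nth] with defaults [u] and [t]; all indices are in range, so they agree. *)
by rewrite (set_nth_default t u) ?(set_nth_default t u (n := i))//= ltnW.
Qed.

Lemma subdivision_sum_ge0 u s : 0 <= subdivision_sum alpha F u s.
Proof. by apply: sumr_ge0 => i _; exact: piece_ge0. Qed.

Lemma subdivision_sum_cat u s s' : subdivision_sum alpha F u (s ++ s') =
  subdivision_sum alpha F u s + subdivision_sum alpha F (last u s) s'.
Proof.
elim: s u => [|t s IH] u /=; last by rewrite !subdivision_sum_cons IH addrA.
by rewrite subdivision_sum_nil add0r.
Qed.

Lemma mesh_le_cons u t s delta :
  mesh_le u (t :: s) delta <-> t - u <= delta /\ mesh_le t s delta.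
Proof.
split=> [h|[h0 h] [|i] //= si].
  split=> [|i si]; first exact: h 0%N _.
  have := h i.+1; rewrite /= ltnS => /(_ si).
  by rewrite (set_nth_default t u) ?(set_nth_default t u (n := i))//= ltnW.
have := h i si.
by rewrite (set_nth_default t u) ?(set_nth_default t u (n := i))//= ltnW.
Qed.

Lemma mesh_le_cat u s s' delta :
  mesh_le u s delta -> mesh_le (last u s) s' delta ->
  mesh_le u (s ++ s') delta.
Proof.
elim: s u => [|t s IH] u //= /mesh_le_cons[tu hs] hs'.
by apply/mesh_le_cons; split => //; exact: IH.
Qed.

Lemma mesh_leW u s delta delta' : delta <= delta' ->
  mesh_le u s delta -> mesh_le u s delta'.
Proof. by move=> dd h i /h /le_trans; apply. Qed.

Lemma subdivision_split u v y delta s : 0 <= alpha ->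
  itv_partition u v s -> mesh_le u s delta -> u <= y -> y <= v ->
  exists s1 s2,
    [/\ itv_partition u y s1 /\ mesh_le u s1 delta,
        itv_partition y v s2 /\ mesh_le y s2 delta &
        subdivision_sum alpha F u s1 + subdivision_sum alpha F y s2 <=
        subdivision_sum alpha F u s + Gamma (alpha + 1) * delta `^ alpha *+ 2].
Proof.
move=> al; have G0 : 0 <= Gamma (alpha + 1) * delta `^ alpha *+ 2.
  by rewrite mulrn_wge0// mulr_ge0 ?Gamma_ge0 ?powR_ge0.
elim: s u => [|t s IH] u [/=].
  move=> _ /eqP <- _ uy yu; have -> : y = u by apply/eqP; rewrite eq_le uy yu.
  exists [::], [::]; split => //.
  by rewrite !subdivision_sum_nil !add0r.
move=> /andP[ut pts] lv /mesh_le_cons[tu mts] uy yv.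
have [yt|ty] := ltP y t; last first.
  have [s1 [s2 [[[p1 l1] m1] h2 hs]]] := IH t (conj pts lv) mts ty yv.
  exists (t :: s1), s2; split => //; last by rewrite !subdivision_sum_cons; lra.
  split; first by split => //=; rewrite ut.
  exact/mesh_le_cons.
(* Subdivision points increase strictly, so [y = u] calls for the empty list on the left. *)
move: uy; rewrite le_eqVlt => /predU1P[<-|uy].
  exists [::], (t :: s); split => //.
  - by split; [|apply/mesh_le_cons]; split => //=; rewrite ut.
  - by rewrite subdivision_sum_nil add0r lerDl.
exists [:: y], (t :: s); split.
- by split; [split => //=; rewrite uy|apply/mesh_le_cons; split => //; lra].
- by split; [split => //=; rewrite yt|apply/mesh_le_cons; split => //; lra].
rewrite !subdivision_sum_cons subdivision_sum_nil addr0 mulr2n.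
have := @piece_le u y delta al (ltW uy).
have := @piece_le y t delta al (ltW yt).
have := piece_ge0 u t.
lra.
Qed.

End Subdivisions.

(** * Additivity of the mass and its smallness on short intervals *)

Section Mass.
Context {R : realType} (alpha : R) (F : set R).
Context (alpha_gt0 : 0 < alpha).
Implicit Types (u v w x y z delta e : R).
Local Open Scope ereal_scope.

Lemma mass_delta_ge0 u v delta : 0 <= mass_delta alpha F u v delta.
Proof. by apply/ereal_infP => _ [s _ <-]; rewrite lee_fin subdivision_sum_ge0. Qed.

Lemma le_mass_delta u v delta delta' : (delta <= delta')%R ->
  mass_delta alpha F u v delta' <= mass_delta alpha F u v delta.
Proof.
move=> dd; apply: ereal_inf_le_tmp => _ [s [us ms] <-].
by exists s => //; split => //; exact: mesh_leW ms.
Qed.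

Lemma mass_delta_cvg u v : mass_delta alpha F u v delta @[delta --> 0^'+] -->
  mass alpha F u v.
Proof.
apply/cvg_ex; eexists.
apply: (nonincreasing_at_right_cvge +oo%O) => // x y _ _; exact: le_mass_delta.
Qed.

Lemma mass_delta_le_mass u v delta : (0 < delta)%R ->
  mass_delta alpha F u v delta <= mass alpha F u v.
Proof.
move=> d0; apply: lime_ge; first exact: mass_delta_cvg.
near=> d; apply: le_mass_delta.
by near: d; exact: nbhs_right_le.
Unshelve. all: by end_near. Qed.

Lemma mass_ge0 u v : 0 <= mass alpha F u v.
Proof. exact: le_trans (mass_delta_ge0 u v 1%R) (mass_delta_le_mass u v ltr01). Qed.

(** Concatenation preserves the mesh bound. The infima are taken one at a time, first over
    subdivisions of [[v, w]], then over those of [[u, v]]. *)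
Lemma mass_delta_triangle u v w delta :
  mass_delta alpha F u w delta <=
  mass_delta alpha F u v delta + mass_delta alpha F v w delta.
Proof.
have H s : itv_partition u v s -> mesh_le u s delta ->
    mass_delta alpha F u w delta - (subdivision_sum alpha F u s)%:E <=
    mass_delta alpha F v w delta.
  move=> [us /eqP ls] ms; apply/ereal_infP => _ [s' [[vs' ls'] ms'] <-].
  rewrite leeBlDl// -EFinD -[X in subdivision_sum alpha F X s']ls -subdivision_sum_cat.
  apply: ereal_inf_lbound; exists (s ++ s') => //; split.
    by split; rewrite ?cat_path ?last_cat ls ?us.
  by apply: mesh_le_cat => //; rewrite ls.
(* Only a finite value can be moved across the inequality; if it is [+oo], so is the right-hand
   side. *)
have := mass_delta_ge0 v w delta.
case E : (mass_delta alpha F v w delta) => [r| |]// _; last first.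
  by rewrite addey ?leey// gt_eqF// (lt_le_trans _ (mass_delta_ge0 _ _ _)).
rewrite -leeBlDr//; apply/ereal_infP => _ [s [us ms] <-].
by have := H s us ms; rewrite E leeBlDr// leeBlDl// addeC.
Qed.

Lemma mass_delta_superadd u v w delta : (u <= v)%R -> (v <= w)%R ->
  mass_delta alpha F u v delta + mass_delta alpha F v w delta <=
  mass_delta alpha F u w delta + (Gamma (alpha + 1) * delta `^ alpha *+ 2)%:E.
Proof.
move=> uv vw; rewrite -leeBlDr//; apply/ereal_infP => _ [s [us ms] <-].
have [s1 [s2 [[h1 m1] [h2 m2] hs]]] :=
  subdivision_split F (ltW alpha_gt0) us ms uv vw.
rewrite leeBlDr// -EFinD; move: hs; rewrite -lee_fin; apply: le_trans.
by rewrite EFinD; apply: leeD; apply: ereal_inf_lbound; [exists s1|exists s2].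
Qed.

Lemma mass_delta_small u v delta : (u <= v)%R -> (v - u <= delta)%R ->
  mass_delta alpha F u v delta <= (Gamma (alpha + 1) * (v - u) `^ alpha)%:E.
Proof.
(* For [u = v] the one-piece list [[:: v]] is not strictly increasing, so the empty one is used. *)
rewrite le_eqVlt => /predU1P[<-|uv] vu.
  apply: le_trans (_ : _ <= (subdivision_sum alpha F u [::])%:E) _.
    by apply: ereal_inf_lbound; exists [::].
  rewrite lee_fin subdivision_sum_nil.
  by rewrite mulr_ge0 ?Gamma_ge0 ?powR_ge0.
apply: le_trans (_ : _ <= (subdivision_sum alpha F u [:: v])%:E) _.
  apply: ereal_inf_lbound; exists [:: v] => //; split; last exact/mesh_le_cons.
  by split => //=; rewrite uv.
rewrite lee_fin subdivision_sum_cons subdivision_sum_nil addr0.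
by apply: piece_le => //; exact: ltW.
Qed.

Lemma powR_gauge_cvg0 :
  (Gamma (alpha + 1) * delta `^ alpha *+ 2)%R @[delta --> 0^'+] --> (0:R)%R.
Proof.
rewrite -[X in _ --> X](mul0rn _ 2) -[X in (X *+ _)%R](mulr0 (Gamma (alpha + 1))).
by apply: cvgMn; apply: cvgMr; exact: powR_cvg0.
Qed.

(** Both inequalities come from the [mass_delta] level by letting the mesh tend to 0; the cutting
    error in [mass_delta_superadd] vanishes because [alpha > 0]. *)
Lemma massD u v w : (u <= v)%R -> (v <= w)%R ->
  mass alpha F u w = mass alpha F u v + mass alpha F v w.
Proof.
move=> uv vw; apply/eqP; rewrite eq_le; apply/andP; split.
  apply: lime_le; first exact: mass_delta_cvg.
  near=> d; have d0 : (0 < d)%R by near: d; exact: nbhs_right_gt.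
  apply: le_trans (mass_delta_triangle u v w d) _.
  by apply: leeD; exact: mass_delta_le_mass.
have H1 : mass_delta alpha F u v d + mass_delta alpha F v w d @[d --> 0^'+] -->
    mass alpha F u v + mass alpha F v w.
  by apply: cvgeD; [exact: ge0_adde_def (mass_ge0 _ _) (mass_ge0 _ _)| |];
    exact: mass_delta_cvg.
have H2 : mass_delta alpha F u w d + (Gamma (alpha + 1) * d `^ alpha *+ 2)%:E
     @[d --> 0^'+] --> mass alpha F u w + 0.
  apply: cvgeD; [by rewrite fin_num_adde_defl|exact: mass_delta_cvg|].
  by apply: cvg_EFin; [near=> d|exact: powR_gauge_cvg0].
rewrite -[leRHS]adde0; apply: (lee_cvg_to H1 H2).
by near=> d; exact: mass_delta_superadd.
Unshelve. all: by end_near. Qed.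

(* A subdivision that is nearly optimal on [u, v] is nearly optimal on each
   subinterval, and a short subinterval is covered by one piece. *)
Lemma mass_small u v e : (0 < e)%R -> mass alpha F u v \is a fin_num ->
  exists2 d, (0 < d)%R & forall y z, (u <= y)%R -> (y <= z)%R -> (z <= v)%R ->
    (z - y < d)%R -> mass alpha F y z <= e%:E.
Proof.
move=> e0 fuv.
have [d1 d10 near_opt] : exists2 d, (0 < d)%R &
    mass alpha F u v - (e / 2)%:E < mass_delta alpha F u v d.
  apply: contrapT => no_d; have : mass alpha F u v <= mass alpha F u v - (e / 2)%:E.
    apply: lime_le; first exact: mass_delta_cvg.
    near=> d; rewrite leNgt; apply/negP => d_opt; apply: no_d.
    by exists d => //; near: d; exact: nbhs_right_gt.
  by apply/negP; rewrite -ltNge lteBlDr// lteDl// lte_fin divr_gt0.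
have /cvgr_lt /(_ (e / 2)%R) : (Gamma (alpha + 1) * d `^ alpha)%R @[d --> 0^'+] -->
    (Gamma (alpha + 1) * 0)%R.
  by apply: cvgMr; exact: powR_cvg0.
rewrite mulr0 divr_gt0// => /(_ isT) piece_small.
have [d [d0 dd1 de]] : exists d, [/\ (0 < d)%R, (d <= d1)%R &
    (Gamma (alpha + 1) * d `^ alpha < e / 2)%R].
  near (0:R)%R^'+ => d; exists d; split; near: d => //.
    exact: nbhs_right_gt.
  exact: nbhs_right_le.
exists d => // y z uy yz zv zyd.
have uz := le_trans uy yz; have yv := le_trans yz zv.
have massE : mass alpha F u v =
    mass alpha F u y + mass alpha F y z + mass alpha F z v.
  by rewrite (massD uz zv) (massD uy yz).
move: (fuv); rewrite massE !fin_numD => /andP[/andP[fuy fyz] fzv].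
(* Bounding the outer parts by their masses and the middle by a single piece leaves, after
   comparison with [near_opt], only [e / 2 + e / 2] for the mass of [[y, z]]. *)
have upper : mass_delta alpha F u v d1 <=
    mass alpha F u y + (e / 2)%:E + mass alpha F z v.
  apply: le_trans (mass_delta_triangle u z v d1) _.
  apply: leeD; last exact: mass_delta_le_mass.
  apply: le_trans (mass_delta_triangle u y z d1) _.
  apply: leeD; first exact: mass_delta_le_mass.
  apply: le_trans (mass_delta_small yz _) _; first by rewrite (le_trans (ltW zyd)).
  rewrite lee_fin (le_trans _ (ltW de))// ler_wpM2l ?Gamma_ge0//.
  by rewrite ge0_ler_powR ?nnegrE ?subr_ge0//; exact: ltW.
have := lt_le_trans near_opt upper; rewrite massE.
move: fuy fyz fzv.
move: (mass alpha F u y) (mass alpha F y z) (mass alpha F z v).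
move=> [k| |] [l| |] [m| |]// _ _ _; rewrite -EFinB -!EFinD !(lte_fin, lee_fin).
lra.
Unshelve. all: by end_near. Qed.

End Mass.

(** * The staircase function and the rules of fractal differentiation *)

Section FractalDerivative.
Context {R : realType} (alpha : R) (F : set R) (a0 : R).
Context (alpha_gt0 : 0 < alpha) (F_perfect : alpha_perfect alpha F a0).
Implicit Types (x y c l m : R) (f g : R -> R).

Let st x := fine (staircase alpha F a0 x).

Lemma staircase_fin x : staircase alpha F a0 x = (st x)%:E.
Proof. by case: F_perfect => fin _ _ _; rewrite fineK. Qed.

(** Additivity of the mass in each of the three positions of [a0] relative to [x] and [y];
    finiteness of the staircase makes the subtraction legitimate. *)
Lemma staircase_increment x y : x <= y ->
  mass alpha F x y \is a fin_num /\ st y - st x = fine (mass alpha F x y).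
Proof.
move=> xy; have [fin _ _ _] := F_perfect.
have := fin x; have := fin y; rewrite /st /staircase.
have [a0x|xa0] := leP a0 x.
  rewrite (le_trans a0x xy) (massD F alpha_gt0 a0x xy).
  move: (mass alpha F a0 x) (mass alpha F x y) => [p| |] [q| |]//= _ _.
  by split=> //; rewrite -?EFinD /=; ring.
have [a0y|ya0] := leP a0 y.
  rewrite (massD F alpha_gt0 (ltW xa0) a0y).
  move: (mass alpha F x a0) (mass alpha F a0 y) => [p| |] [q| |]//= _ _.
  by split=> //; rewrite -?EFinD /=; ring.
rewrite (massD F alpha_gt0 xy (ltW ya0)).
move: (mass alpha F x y) (mass alpha F y a0) => [p| |] [q| |]//= _ _.
by split=> //; rewrite -?EFinD /=; ring.
Qed.

Lemma staircase_le x y : x <= y -> st x <= st y.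
Proof.
by move=> xy; rewrite -subr_ge0 (staircase_increment xy).2 fine_ge0 ?mass_ge0.
Qed.

Lemma staircase_constP x c d : c < x < d -> F x ->
  exists2 y, y \in `]c, d[ & st y != st x.
Proof.
move=> cxd; have [_ _ _ ->] := F_perfect => /(_ c d cxd) nconst.
apply: contrapT => no_y; apply: nconst; exists (st x)%:E => y ycd.
rewrite staircase_fin; suff -> : st y = st x by [].
by apply: contrapT => /eqP yx; apply: no_y; exists y.
Qed.

Instance Fnear_filter x : Filter (Fnear F x).
Proof. by rewrite /Fnear; exact: within_filter. Qed.

Lemma Fnear_nbhs (P : set R) x :
  (\forall y \near x, y != x -> F y -> P y) -> Fnear F x P.
Proof. exact. Qed.

(** Otherwise [x] would be an isolated point of [F]. Properness makes F-limits unique, so that [lim]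
    can be evaluated. *)
Lemma Fnear_proper x : F x -> ProperFilter (Fnear F x).
Proof.
move=> Fx; have [_ cF iF _] := F_perfect; split; last exact: Fnear_filter.
rewrite /Fnear /dnbhs /within/= => near_x.
have : isolated F x.
  split; first exact: mem_set.
  exists (fun y => y != x -> F y -> False) => //.
  apply/seteqP; split=> [y [yx Fy]|y ->]; last by split; rewrite ?eqxx.
  by apply: contrapT => ne; apply: yx Fy; exact/eqP.
by rewrite iF.
Qed.

(** This makes the denominators of [Fquotient] nonzero near [x]. On each side, either some point [c]
    of [F] shares the value at [x], and then [F] has no point between them, or there is none and any
    bound will do, here at distance 1. *)
Lemma staircase_Fneq x : F x -> \forall y \near Fnear F x, st y != st x.
Proof.
move=> Fx.
(* By monotonicity equal end values make [st] constant on [[y, z]], against [staircase_constP] at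
   [t]. *)
have flat y z t : F t -> y < t < z -> st y = st z -> False.
  move=> Ft /[dup] yz /andP[yt tz] e.
  have [u] := staircase_constP yz Ft; rewrite in_itv/= => /andP[yu uz].
  have := staircase_le (ltW yu); have := staircase_le (ltW uz).
  have := staircase_le (ltW yt); have := staircase_le (ltW tz).
  move: (st y) (st t) (st u) (st z) e => p q r s e ? ? ? ? /eqP.
  by apply; lra.
have left : exists2 c, c < x & forall y, F y -> c < y < x -> st y != st x.
  have [[c [Fc cx e]]|no_c] := pselect (exists c, [/\ F c, c < x & st c = st x]).
    by exists c; [exact: cx|move=> y Fy cyx; case: (flat _ _ _ Fy cyx e)].
  exists (x - 1); first by lra.
  move=> y Fy /andP[_ yx]; apply/eqP => e; apply: no_c.
  by exists y; exact: And3 Fy yx e.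
have right : exists2 c, x < c & forall y, F y -> x < y < c -> st y != st x.
  have [[c [Fc cx e]]|no_c] := pselect (exists c, [/\ F c, x < c & st x = st c]).
    by exists c; [exact: cx|move=> y Fy cyx; case: (flat _ _ _ Fy cyx e)].
  exists (x + 1); first by lra.
  move=> y Fy /andP[yx _]; apply/eqP => e; apply: no_c.
  by exists y; exact: And3 Fy yx (esym e).
have [c cx hc] := left; have [d xd hd] := right.
apply: Fnear_nbhs; have : x \in `]c, d[ by rewrite in_itv/= cx.
move=> /near_in_itvoo; apply: filterS => y; rewrite in_itv/= => /andP[cy yd].
rewrite neq_lt => /orP[yx|xy] Fy; first by apply: hc; rewrite ?cy.
by apply: hd; rewrite ?xy.
Qed.

(** The increment of [st] is the mass of the interval between the two points, small by [mass_small]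
    on the window [[x - 1, x + 1]], whose mass is finite. *)
Lemma staircase_Fcvg x : st y @[y --> Fnear F x] --> st x.
Proof.
have [fin _] := @staircase_increment (x - 1) (x + 1) ltac:(lra).
apply/cvgrPdist_le => e e0.
have [d d0 small] := mass_small alpha_gt0 e0 fin.
have near_x : \forall y \near x, `|st x - st y| <= e.
  near=> y.
  have yd : `|x - y| < d by near: y; exact: (nbhsx_ballx x d d0).
  have y1 : `|x - y| < 1 by near: y; exact: (nbhsx_ballx x 1 ltr01).
  move: yd y1; rewrite !ltr_norml => /andP[? ?] /andP[? ?].
  have [xy|/ltW yx] := leP x y.
    have [fxy inc] := staircase_increment xy.
    rewrite distrC {}inc ger0_norm ?fine_ge0 ?mass_ge0// -lee_fin fineK//.
    by apply: small; lra.
  have [fxy inc] := staircase_increment yx.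
  rewrite {}inc ger0_norm ?fine_ge0 ?mass_ge0// -lee_fin fineK//.
  by apply: small; lra.
by apply: Fnear_nbhs; apply: filterS near_x.
Unshelve. all: by end_near. Qed.

(** Existence and value of the derivative in one relation, so that the differentiation rules reduce
    to limit rules. *)
Definition is_Fderive f x l : Prop :=
  Fquotient alpha F a0 f x y @[y --> Fnear F x] --> l.

Lemma FderivableP f x :
  Fderivable alpha F a0 f x -> F x -> is_Fderive f x (Fderive alpha F a0 f x).
Proof. by move=> df Fx; rewrite /Fderive mem_set. Qed.

Lemma is_FderiveE f x l : F x -> is_Fderive f x l ->
  Fderivable alpha F a0 f x /\ Fderive alpha F a0 f x = l.
Proof.
move=> Fx dl; have PF := Fnear_proper Fx; split; first by apply/cvg_ex; exists l.
by rewrite /Fderive mem_set//; exact: cvg_lim.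
Qed.

Lemma is_Fderive_eq f x l m : l = m -> is_Fderive f x l -> is_Fderive f x m.
Proof. by move=> ->. Qed.

(** Lets an iterated derivative be computed from a formula valid only on [F] near [x]. *)
Lemma is_Fderive_near f g x l : F x -> {near x, forall y, F y -> f y = g y} ->
  is_Fderive f x l -> is_Fderive g x l.
Proof.
move=> Fx fg; apply: cvg_trans; apply: near_eq_cvg.
have fgx : f x = g x by apply: nbhs_singleton fg Fx.
apply: Fnear_nbhs; apply: filterS fg => y fgy _ Fy.
by rewrite /Fquotient fgx fgy.
Qed.

(** Write [f y] as [f x] plus the quotient times [st y - st x], valid where [st y != st x]; the last
    factor tends to 0. *)
Lemma is_Fderive_cvg f x l : F x -> is_Fderive f x l ->
  f y @[y --> Fnear F x] --> f x.
Proof.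
move=> Fx df.
have dst : st y - st x @[y --> Fnear F x] --> 0.
  rewrite -[X in _ --> X](subrr (st x)).
  by apply: cvgB; [exact: staircase_Fcvg|exact: cvg_cst].
have : f x + Fquotient alpha F a0 f x y * (st y - st x) @[y --> Fnear F x] -->
    f x + l * 0.
  by apply: cvgD; [exact: cvg_cst|exact: cvgM].
rewrite mulr0 addr0; apply: cvg_trans; apply: near_eq_cvg.
near=> y; rewrite /Fquotient divfK; first by rewrite addrC subrK.
by rewrite subr_eq0; near: y; exact: staircase_Fneq.
Unshelve. all: by end_near. Qed.

Lemma is_FderiveD f g x l m : is_Fderive f x l -> is_Fderive g x m ->
  is_Fderive (fun y => f y + g y) x (l + m).
Proof.
move=> df dg; apply: cvg_trans (cvgD df dg); apply: near_eq_cvg.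
by apply: nearW => y; rewrite /Fquotient -mulrDl opprD addrACA.
Qed.

Lemma is_FderiveB f g x l m : is_Fderive f x l -> is_Fderive g x m ->
  is_Fderive (fun y => f y - g y) x (l - m).
Proof.
move=> df dg; apply: cvg_trans (cvgB df dg); apply: near_eq_cvg.
by apply: nearW => y; rewrite /Fquotient -mulrBl !opprD !opprK addrACA.
Qed.

(** The increment of the product is [(f y - f x) * g x + f y * (g y - g x)]; the factor [f y] tends
    to [f x] by [is_Fderive_cvg]. *)
Lemma is_FderiveM f g x l m : F x -> is_Fderive f x l -> is_Fderive g x m ->
  is_Fderive (fun y => f y * g y) x (l * g x + f x * m).
Proof.
move=> Fx df dg; have cf := is_Fderive_cvg Fx df.
have : Fquotient alpha F a0 f x y * g x + f y * Fquotient alpha F a0 g x y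
    @[y --> Fnear F x] --> l * g x + f x * m.
  by apply: cvgD; apply: cvgM => //; exact: cvg_cst.
apply: cvg_trans; apply: near_eq_cvg; apply: nearW => y.
by rewrite /Fquotient; ring.
Qed.

End FractalDerivative.

(** * Exactness after multiplication by a solution of the adjoint equation *)

Theorem theorem5 (R : realType) (alpha : R) (F : set R) (a0 a b : R)
    (P Q S mu : R -> R)
    (alpha_gt0 : 0 < alpha) (alpha_le1 : alpha <= 1)
    (F_perfect : alpha_perfect alpha F a0) (ab : a < b)
    (P_C2 : Cn alpha F a0 a b 2 P)
    (Q_C1 : Cn alpha F a0 a b 1 Q)
    (S_cont : Fcontinuous F a b S)
    (not_exact : ~ exact_equation alpha F a0 a b P Q S)
    (mu_C2 : Cn alpha F a0 a b 2 mu)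
    (mu_adjoint : forall x, F x -> a < x < b ->
       P x * Fderiven alpha F a0 2 mu x
       + (2 * Fderive alpha F a0 P x - Q x) * Fderive alpha F a0 mu x
       + (Fderiven alpha F a0 2 P x - Fderive alpha F a0 Q x + S x) * mu x
       = 0) :
  exact_equation alpha F a0 a b
    (fun x => mu x * P x) (fun x => mu x * Q x) (fun x => mu x * S x).
Proof.
pose D := Fderive alpha F a0.
have D1 h x : Cn alpha F a0 a b 1 h -> F x -> a < x < b ->
    is_Fderive alpha F a0 h x (D h x).
  by move=> h1 Fx xab; exact: FderivableP (h1 0%N _ x Fx xab) Fx.
have D2 h x : Cn alpha F a0 a b 2 h -> F x -> a < x < b ->
    is_Fderive alpha F a0 (D h) x (D (D h) x).
  by move=> h2 Fx xab; exact: FderivableP (h2 1%N _ x Fx xab) Fx.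
have C21 h : Cn alpha F a0 a b 2 h -> Cn alpha F a0 a b 1 h.
  by move=> h2 k k1; apply: h2; exact: ltnW.
have FM := is_FderiveM alpha_gt0 F_perfect.
pose muP y := mu y * P y.
have dmuP x : F x -> a < x < b ->
    is_Fderive alpha F a0 muP x (D mu x * P x + mu x * D P x).
  move=> Fx xab.
  exact: FM _ _ _ _ _ Fx (D1 _ _ (C21 _ mu_C2) Fx xab) (D1 _ _ (C21 _ P_C2) Fx xab).
have DmuP x : F x -> a < x < b -> D muP x = D mu x * P x + mu x * D P x.
  by move=> Fx xab; have [] := is_FderiveE F_perfect Fx (dmuP _ Fx xab).
have dDmuP x : F x -> a < x < b -> is_Fderive alpha F a0 (D muP) x
    ((D (D mu) x * P x + D mu x * D P x) + (D mu x * D P x + mu x * D (D P) x)).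
  move=> Fx xab.
  (* The formula [DmuP] holds at all points of [F] in [(a, b)], hence on [F] near [x]. *)
  apply: (@is_Fderive_near _ _ _ _ (fun y => D mu y * P y + mu y * D P y)) => //.
    near=> y => Fy; rewrite DmuP//.
    by near: y; have := @near_in_itvoo _ a b x; rewrite in_itv/= => /(_ xab); exact.
  exact: is_FderiveD
    (FM _ _ _ _ _ Fx (D2 _ _ mu_C2 Fx xab) (D1 _ _ (C21 _ P_C2) Fx xab))
    (FM _ _ _ _ _ Fx (D1 _ _ (C21 _ mu_C2) Fx xab) (D2 _ _ P_C2 Fx xab)).
pose g y := mu y * Q y - D muP y.
have dg x : F x -> a < x < b -> is_Fderive alpha F a0 g x (mu x * S x).
  move=> Fx xab; have adj := mu_adjoint _ Fx xab.
  have dmuQ : is_Fderive alpha F a0 (fun y => mu y * Q y) x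
      (D mu x * Q x + mu x * D Q x).
    exact: FM _ _ _ _ _ Fx (D1 _ _ (C21 _ mu_C2) Fx xab) (D1 _ _ Q_C1 Fx xab).
  apply: is_Fderive_eq (is_FderiveB dmuQ (dDmuP _ Fx xab)).
  (* The difference of the two sides is minus the left-hand side of the adjoint equation. *)
  by apply/eqP; rewrite -subr_eq0 -oppr_eq0; apply/eqP; rewrite -[RHS]adj /D /=; ring.
exists g => [[|//] _ x Fx xab|f fC2 x Fx xab Df].
  by have [] := is_FderiveE F_perfect Fx (dg _ Fx xab).
have [d1 e1] := is_FderiveE F_perfect Fx
  (FM _ _ _ _ _ Fx (dmuP _ Fx xab) (D2 _ _ fC2 Fx xab)).
have [d2 e2] := is_FderiveE F_perfect Fx
  (FM _ _ _ _ _ Fx (dg _ Fx xab) (D1 _ _ (C21 _ fC2) Fx xab)).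
split => //.
(* The term [D muP x * D f x] from the first product cancels the one contributed by
   [g x * D f x]. *)
by rewrite /Df e1 e2 /g DmuP// /muP /D /=; ring.
Unshelve. all: by end_near. Qed.
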